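(* Let $L$ be a simple Lie algebra over a field $K$ of characteristic different from $2$ and $3$ (not necessarily finite-dimensional). Then $L$ possesses a nonzero commutative $2$-cocycle if and only if $L$ satisfies the standard identity of degree $5$, i.e. $$\sum_{\sigma\in S_4}\operatorname{sgn}(\sigma)\,[[[[y,x_{\sigma(1)}],x_{\sigma(2)}],x_{\sigma(3)}],x_{\sigma(4)}]=0$$ for all $x_1,x_2,x_3,x_4,y\in L$.
   Context: A commutative $2$-cocycle on a Lie algebra $L$ over $K$ is a symmetric bilinear form $\varphi:L\times L\to K$ such that $\varphi([x,y],z)+\varphi([z,x],y)+\varphi([y,z],x)=0$ for all $x,y,z\in L$. $S_4$ is the symmetric group on $\{1,2,3,4\}$. *)

(* Defs.v *)
From HB Require Import structures.
From mathcomp Require Import all_boot all_order all_algebra all_fingroup.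
Set Implicit Arguments. Unset Strict Implicit. Unset Printing Implicit Defensive.
Import GRing.Theory.
Local Open Scope ring_scope.

Definition is_lie (K : fieldType) (V : lmodType K) (br : V -> V -> V) : Prop :=
  [/\ (forall (a : K) (x y z : V), br (a *: x + y) z = a *: br x z + br y z),
      (forall (a : K) (x y z : V), br z (a *: x + y) = a *: br z x + br z y),
      (forall x : V, br x x = 0) &
      (forall x y z : V, br x (br y z) + br y (br z x) + br z (br x y) = 0)].

Definition lie_ideal (K : fieldType) (V : lmodType K) (br : V -> V -> V)
    (I : V -> Prop) : Prop :=
  [/\ I 0,
      (forall (a : K) (x y : V), I x -> I y -> I (a *: x + y)) &
      (forall x y : V, I y -> I (br x y))].

Definition simple_lie (K : fieldType) (V : lmodType K) (br : V -> V -> V) : Prop :=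
  (exists x y : V, br x y != 0) /\
  (forall I : V -> Prop, lie_ideal br I ->
     (forall x, I x -> x = 0) \/ (forall x, I x)).

Definition comm_cocycle (K : fieldType) (V : lmodType K) (br : V -> V -> V)
    (phi : V -> V -> K) : Prop :=
  [/\ (forall (a : K) (x y z : V), phi (a *: x + y) z = a * phi x z + phi y z),
      (forall (a : K) (x y z : V), phi z (a *: x + y) = a * phi z x + phi z y),
      (forall x y : V, phi x y = phi y x) &
      (forall x y z : V, phi (br x y) z + phi (br z x) y + phi (br y z) x = 0)].

(* The standard identity of degree 5 (indices 1..4 of the paper are 0..3). *)
Definition standard5 (K : fieldType) (V : lmodType K) (br : V -> V -> V) : Prop :=
  forall (x : 'I_4 -> V) (y : V),
    \sum_(s : 'S_4) ((-1) ^+ odd_perm s : K) *: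
       br (br (br (br y (x (s (inord 0)))) (x (s (inord 1))))
              (x (s (inord 2)))) (x (s (inord 3))) = 0.

(* Main.v *)
(** If [phi] is a commutative 2-cocycle, then [phi (s5 (y; x1, .., x4)) z = 0],
    where [s5] is the standard polynomial: [12 phi (s5 (y; x)) z] is a
    skew-symmetrised integral combination of instances of the cocycle identity.
    The values of [s5] span an ideal, so in a simple algebra either they all
    vanish or [phi = 0].

    Conversely, the Lie polynomial
    [F(a,b;c,d) = [[[c,d],a],b] + [[[c,d],b],a] + 2[[a,c],[b,d]] + 2[[b,c],[a,d]]]
    is symmetric in [a, b], and modulo [s5] it satisfies the cocycle identity in
    [a, b]:
    [F([x,y],z;c,d) + cyclic = 2 s5 (c; d,x,y,z) - 2 s5 (d; c,x,y,z)].
    Composing with a linear form gives a nonzero cocycle unless [F] vanishes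
    identically. In that case [F(a,a;x,a) = 2 [[[x,a],a],a]] shows that
    [(ad a)^3 = 0] for all [a], which is impossible in a simple algebra: the
    element [c = [[b,a],a]] satisfies [(ad c)^2 = 0], and any such [c] generates
    an abelian ideal, hence is zero; so [(ad a)^2 = 0] and then [a = 0] for all [a]. *)
Require Import Defs.
From HB Require Import structures.
From mathcomp Require Import all_boot all_order all_algebra all_fingroup.
From mathcomp Require Import boolp classical_sets.
Set Implicit Arguments.
Unset Strict Implicit.
Unset Printing Implicit Defensive.
Import GRing.Theory.
Local Open Scope ring_scope.

(** * Formal integer combinations and their evaluation in a module *)

Section Combination.
Variables (T : Type) (R : nzRingType) (M : lmodType R).
Implicit Types (s : seq (int * T)) (g : T -> M).

Definition leval g s : M := \sum_(p <- s) p.1%:~R *: g p.2.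

Definition scale_terms (a : int) s := [seq (a * p.1, p.2) | p <- s].

Definition subst_terms (U : Type) (s : seq (int * U)) (f : U -> seq (int * T)) :=
  [seq (p.1 * q.1, q.2) | p <- s, q <- f p.2].

Lemma leval_cons g p s : leval g (p :: s) = p.1%:~R *: g p.2 + leval g s.
Proof. by rewrite /leval big_cons. Qed.

Lemma leval_cat g s t : leval g (s ++ t) = leval g s + leval g t.
Proof. by rewrite /leval big_cat. Qed.

Lemma eq_leval g h s : g =1 h -> leval g s = leval h s.
Proof. by move=> gh; apply: eq_bigr => p _; rewrite gh. Qed.

Lemma leval_scale g a s : leval g (scale_terms a s) = a%:~R *: leval g s.
Proof.
rewrite /leval big_map scaler_sumr; apply: eq_bigr => p _.
by rewrite scalerA intrM.
Qed.

End Combination.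

Lemma leval_subst (T U : Type) (R : nzRingType) (M : lmodType R) (g : T -> M)
    (s : seq (int * U)) (f : U -> seq (int * T)) :
  leval g (subst_terms s f) = leval (fun k => leval g (f k)) s.
Proof.
rewrite /leval big_allpairs_dep; apply: eq_bigr => p _ /=.
by rewrite scaler_sumr; apply: eq_bigr => q _; rewrite scalerA intrM.
Qed.

Section Collect.
Variables (T : eqType) (R : nzRingType) (M : lmodType R).
Implicit Types (s : seq (int * T)) (g : T -> M).

Fixpoint insert_term (c : int) (k : T) s :=
  if s is (d, l) :: s' then
    if k == l then (c + d, l) :: s' else (d, l) :: insert_term c k s'
  else [:: (c, k)].

Definition collect s := foldr (fun p => insert_term p.1 p.2) [::] s.

(** A computable test, sufficient for the combination to evaluate to zero in every module. *)
Definition vanishes s := all (fun p => p.1 == 0) (collect s).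

Lemma leval_insert g c k s :
  leval g (insert_term c k s) = c%:~R *: g k + leval g s.
Proof.
elim: s => [|[d l] s IHs] /=; first by rewrite leval_cons.
case: eqP => [->|_]; rewrite !leval_cons /=; first by rewrite intrD scalerDl addrA.
by rewrite IHs addrCA.
Qed.

Lemma leval_collect g s : leval g (collect s) = leval g s.
Proof. by elim: s => //= p s IHs; rewrite leval_insert IHs leval_cons. Qed.

Lemma leval_vanishes g s : vanishes s -> leval g s = 0.
Proof.
rewrite -leval_collect /vanishes /leval; elim: (collect s) => [|p t IHt] /=.
  by rewrite big_nil.
by case/andP => /eqP p0 /IHt t0; rewrite big_cons p0 t0 scale0r addr0.
Qed.

End Collect.

(** * Signed permutations as a computable list *)

(** Recursion on the first value [j]: [bump j] renumbers the other values to skip [j], and moving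
    [j] to the front costs [j] transpositions, whence the sign [odd j]. *)
Fixpoint signed_perms n : seq (bool * seq nat) :=
  if n is m.+1 then
    [seq (odd j (+) p.1, j :: [seq bump j i | i <- p.2])
       | j <- index_iota 0 m.+1, p <- signed_perms m]
  else [:: (false, [::])].

Definition perm_vals n (s : 'S_n) : seq nat := [seq val (s i) | i <- enum 'I_n].

Lemma perm_vals_lift n (j : 'I_n.+1) (s : 'S_n) :
  perm_vals (lift_perm ord0 j s) = val j :: [seq bump j i | i <- perm_vals s].
Proof.
rewrite /perm_vals enum_ordSl /= lift_perm_id -!map_comp; congr (_ :: _).
by apply: eq_map => i /=; rewrite lift_perm_lift.
Qed.

Lemma big_perm_ord0 (R : nmodType) n (G : 'S_n.+1 -> R) :
  \sum_(s : 'S_n.+1) G s = \sum_(j < n.+1) \sum_(s : 'S_n) G (lift_perm ord0 j s).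
Proof.
pose h (p : 'I_n.+1 * 'S_n) := lift_perm ord0 p.1 p.2.
have h_inj : injective h.
  move=> [j s] [k t] /permP /= eq_st.
  have ejk : j = k by have := eq_st ord0; rewrite !lift_perm_id.
  congr (_, _) => //; apply/permP => i; apply: (@lift_inj _ j).
  by have := eq_st (lift ord0 i); rewrite !lift_perm_lift ejk.
have h_bij : bijective h.
  by apply: inj_card_bij => //; rewrite card_prod card_ord !card_Sn factS.
by rewrite pair_big_dep (reindex h) //; apply: onW_bij.
Qed.

Lemma sum_signed_perms (R : nmodType) n (G : bool -> seq nat -> R) :
  \sum_(s : 'S_n) G (odd_perm s) (perm_vals s)
    = \sum_(p <- signed_perms n) G p.1 p.2.
Proof.
elim: n G => [|n IHn] G.
  rewrite big_seq1 (big_pred1 1%g) => [|s].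
    by rewrite odd_perm1 /perm_vals enum_ord0.
  by apply/esym/eqP/permP => -[].
rewrite big_perm_ord0 [signed_perms _]/(allpairs_dep _ _ _) big_allpairs_dep.
rewrite big_mkord; apply: eq_bigr => j _.
rewrite -(IHn (fun b t => G (odd j (+) b) (val j :: [seq bump j i | i <- t]))).
by apply: eq_bigr => s _; rewrite perm_vals_lift odd_lift_perm.
Qed.

(** * A linear form that is nonzero at a given vector *)

Lemma linear_form_neq0 (K : fieldType) (V : lmodType K) (v : V) : v != 0 ->
  exists f : V -> K,
    (forall a x y, f (a *: x + y) = a * f x + f y) /\ f v != 0.
Proof.
(* A subspace maximal among those avoiding [v] is a complement of the line [K v]. *)
move=> v0.
pose P (A : set V) :=
  (forall a x y, A x -> A y -> A (a *: x + y)) /\ ~ A v.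
have [F FP Ftot|W [[Wlin Wv] Wmax]] := @Zorn_bigcup V P.
  split=> [a x y [A FA Ax] [B FB By]|[A FA Av]]; last by have [_] := FP _ FA.
  have [AB|BA] := Ftot _ _ FA FB.
    by exists B => //; have [Blin _] := FP _ FB; apply: Blin => //; apply: AB.
  by exists A => //; have [Alin _] := FP _ FA; apply: Alin => //; apply: BA.
have W0 : W 0.
  (* If [W] misses 0 then it is empty, and the zero subspace is a larger candidate. *)
  apply: contrapT => nW0; apply: (Wmax (fun x => x = 0)); last first.
    by split=> [a x y -> ->|/eqP]; [rewrite scaler0 addr0|rewrite (negPf v0)].
  split=> [x Wx|sub0]; last by apply: nW0; apply: sub0.
  by case: nW0; rewrite -(subrr x) -scaleN1r addrC; apply: Wlin.
have Wscale a x : W x -> W (a *: x).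
  by move=> Wx; rewrite -[_ *: _]addr0; apply: Wlin.
have WB x y : W x -> W y -> W (x - y).
  by move=> Wx Wy; rewrite addrC -scaleN1r; apply: Wlin.
have Wv_eq0 a : W (a *: v) -> a = 0.
  move=> Wav; apply: contrapT => /eqP a0; apply: Wv.
  by rewrite -[v]scale1r -(mulVf a0) -scalerA; apply: Wscale.
have dec x : exists a, W (x - a *: v).
  have [Wx|nWx] := EM (W x); first by exists 0; rewrite scale0r subr0.
  (* If [x] is not in [W], then [W + K x] is strictly larger, so it contains [v]; solving for [x]
     gives the coefficient [c^-1]. *)
  pose Wx : set V := fun y => exists a, W (y - a *: x).
  apply: contrapT => nodec; apply: (Wmax Wx); last split.
  - split=> [y Wy|/(_ x) sub]; first by exists 0; rewrite scale0r subr0.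
    by apply: nWx; apply: sub; exists 1; rewrite scale1r subrr.
  - move=> a y z [b Wy] [c Wz]; exists (a * b + c).
    have -> : a *: y + z - (a * b + c) *: x = a *: (y - b *: x) + (z - c *: x).
      by rewrite scalerDl scalerBr scalerA opprD addrACA.
    exact: Wlin.
  - case=> c Wc; apply: nodec; have [c0|c0] := eqVneq c 0.
      by case: Wv; move: Wc; rewrite c0 scale0r subr0.
    exists c^-1; rewrite -opprB -scaleN1r; apply: (Wscale).
    by rewrite -[x]scale1r -(mulVf c0) -scalerA -scalerBr; apply: Wscale.
have [f fP] := choice dec; exists f; split=> [a x y|].
  apply/eqP; rewrite -subr_eq0; apply/eqP; apply: Wv_eq0.
  have -> : (f (a *: x + y) - (a * f x + f y)) *: v =
      a *: (x - f x *: v) + (y - f y *: v)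
      - (a *: x + y - f (a *: x + y) *: v).
    rewrite scalerBl scalerDl scalerBr scalerA [in RHS]addrACA -opprD opprB.
    by rewrite [RHS]addrC addrA subrK.
  by apply: WB => //; apply: Wlin.
apply/eqP => fv0; apply: Wv; have := fP v.
by rewrite fv0 scale0r subr0.
Qed.

(** * Lie monomials, normal forms and computed certificates *)

Inductive lie_tree := Leaf of nat | Node of lie_tree & lie_tree.

Fixpoint leaves t : seq nat :=
  match t with Leaf i => [:: i] | Node l r => leaves l ++ leaves r end.

(* The pair [(i, w)] stands for the left-normed bracket of the letters of
   [i :: w]. *)
Notation lie_word := (nat * seq nat)%type.

Fixpoint bracket_word (w : lie_word) t : seq (int * lie_word) :=
  match t with
  | Leaf i => [:: (1, (w.1, rcons w.2 i))]
  | Node l r =>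
      subst_terms (bracket_word w l) (fun v => bracket_word v r)
      ++ scale_terms (-1) (subst_terms (bracket_word w r) (fun v => bracket_word v l))
  end.

(* A multilinear tree containing the letter [m] is written in the basis of the
   left-normed words that start with [m]. *)
Fixpoint normal_form (m : nat) t : seq (int * lie_word) :=
  match t with
  | Leaf i => [:: (1, (i, [::]))]
  | Node l r =>
      if m \in leaves l then
        subst_terms (normal_form m l) (fun w => bracket_word w r)
      else
        scale_terms (-1) (subst_terms (normal_form m r) (fun w => bracket_word w l))
  end.

Definition std_tree (y : lie_tree) (xs : seq lie_tree) : seq (int * lie_tree) :=
  [seq ((-1) ^+ nat_of_bool p.1, foldl Node y [seq nth y xs i | i <- p.2])
     | p <- signed_perms 4].

Definition lie_vanishes (s : seq (int * lie_tree)) :=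
  vanishes (subst_terms s (normal_form 0)).

(** Trees on the same letters get the same distinguished letter, hence normal forms in the same
    basis. *)
Fixpoint min_leaf t : nat :=
  match t with Leaf i => i | Node l r => minn (min_leaf l) (min_leaf r) end.

(* The letters of the two words are disjoint in a multilinear expression, so
   comparing the first ones suffices. *)
Definition sort_pair (v w : lie_word) :=
  if (v.1 <= w.1)%N then (v, w) else (w, v).

Definition pair_normal_form (p : lie_tree * lie_tree) :
    seq (int * (lie_word * lie_word)) :=
  subst_terms (normal_form (min_leaf p.1) p.1) (fun v =>
    [seq (q.1, sort_pair v q.2) | q <- normal_form (min_leaf p.2) p.2]).

Definition pair_vanishes s := vanishes (subst_terms s pair_normal_form).

Definition cocycle_terms (u v w : lie_tree) : seq (int * (lie_tree * lie_tree)) :=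
  [:: (1, (Node u v, w)); (1, (Node w u, v)); (1, (Node v w, u))].

(* Found by solving the linear system satisfied by the cocycle identities of
   degree 6 that are skew-symmetric in four letters; the coefficients have been
   multiplied by 12. *)
Definition std_coefficients (x : nat -> lie_tree) (y z : lie_tree) :
    seq (int * (lie_tree * lie_tree * lie_tree)) :=
  let b := Node in
  let x0 := x 0%N in let x1 := x 1%N in let x2 := x 2%N in let x3 := x 3%N in
  [:: (4, (b (b (b y x0) x1) x2, x3, z));
      (4, (b (b y x0) x1, b x2 x3, z));
      (1, (b (b (b y x0) x1) z, x2, x3));
      (2, (b (b (b y x0) z) x1, x2, x3));
      (-2, (b (b y x0) x1, b x2 z, x3));
      (1, (b (b y x0) z, b x1 x2, x3));
      (-2, (b (b y z) x0, b x1 x2, x3));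
      (1, (b y x0, b (b x1 x2) z, x3));
      (-1, (b y x0, b x1 x2, b x3 z));
      (-2, (y, b (b (b x0 x1) z) x2, x3));
      (1, (y, b (b x0 x1) z, b x2 x3))].

(** Letters 0 to 3 are the alternating arguments, 4 is [y] and 5 is the second argument of the
    form. *)
Definition std_certificate : seq (int * (lie_tree * lie_tree)) :=
  scale_terms 12
    [seq (p.1, (p.2, Leaf 5)) | p <- std_tree (Leaf 4) [seq Leaf j | j <- iota 0 4]]
  ++ scale_terms (-1)
    (subst_terms [seq ((-1) ^+ nat_of_bool p.1, p.2) | p <- signed_perms 4]
      (fun s => subst_terms
         (std_coefficients (fun i => Leaf (nth 0%N s i)) (Leaf 4) (Leaf 5))
         (fun t => cocycle_terms t.1.1 t.1.2 t.2))).

Lemma std_certificate_vanishes : pair_vanishes std_certificate.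
Proof. by vm_compute. Qed.

(* The coefficients are chosen so that, on vector fields [a D] and [b D] on a
   line, the value depends on [a] and [b] only through derivatives of [ab]. *)
Definition cocycle_poly_terms (a b c d : lie_tree) : seq (int * lie_tree) :=
  [:: (1, Node (Node (Node c d) a) b); (1, Node (Node (Node c d) b) a);
      (2, Node (Node a c) (Node b d)); (2, Node (Node b c) (Node a d))].

Definition cocycle_poly_certificate : seq (int * lie_tree) :=
  let c := Leaf 0 in let d := Leaf 1 in
  let x := Leaf 2 in let y := Leaf 3 in let z := Leaf 4 in
  (cocycle_poly_terms (Node x y) z c d ++ cocycle_poly_terms (Node z x) y c d
     ++ cocycle_poly_terms (Node y z) x c d)
  ++ scale_terms (-2) (std_tree c [:: d; x; y; z])
  ++ scale_terms 2 (std_tree d [:: c; x; y; z]).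

Lemma cocycle_poly_certificate_vanishes : lie_vanishes cocycle_poly_certificate.
Proof. by vm_compute. Qed.

(** * Evaluation of trees in a Lie algebra *)

Section LieAlgebra.
Variables (K : fieldType) (V : lmodType K) (br : V -> V -> V).
Hypothesis lie : is_lie br.

Lemma brDl x y z : br (x + y) z = br x z + br y z.
Proof. by case: lie => brl _ _ _; have := brl 1 x y z; rewrite !scale1r. Qed.

Lemma brDr x y z : br z (x + y) = br z x + br z y.
Proof. by case: lie => _ brr _ _; have := brr 1 x y z; rewrite !scale1r. Qed.

Lemma br0l z : br 0 z = 0.
Proof. by apply: (addrI (br 0 z)); rewrite -brDl !addr0. Qed.

Lemma br0r z : br z 0 = 0.
Proof. by apply: (addrI (br z 0)); rewrite -brDr !addr0. Qed.

Lemma brZl a x z : br (a *: x) z = a *: br x z.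
Proof. by case: lie => brl _ _ _; have := brl a x 0 z; rewrite br0l !addr0. Qed.

Lemma brZr a x z : br z (a *: x) = a *: br z x.
Proof. by case: lie => _ brr _ _; have := brr a x 0 z; rewrite br0r !addr0. Qed.

Lemma brNl x z : br (- x) z = - br x z.
Proof. by rewrite -scaleN1r brZl scaleN1r. Qed.

Lemma brNr x z : br z (- x) = - br z x.
Proof. by rewrite -scaleN1r brZr scaleN1r. Qed.

Lemma brxx x : br x x = 0.
Proof. by case: lie. Qed.

Lemma brC x y : br x y = - br y x.
Proof.
apply/eqP; rewrite -addr_eq0; apply/eqP.
by have := brxx (x + y); rewrite brDl !brDr !brxx add0r addr0.
Qed.

Lemma br_jacobi x y z : br x (br y z) = br (br x y) z - br (br x z) y.
Proof.
case: lie => _ _ _ jac; have := jac x y z.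
rewrite (brC y (br z x)) (brC z (br x y)) (brC z x) brNl opprK => /eqP.
by rewrite subr_eq0 => /eqP <-; rewrite addrK.
Qed.

Lemma br_suml (I : Type) (r : seq I) (f : I -> V) z :
  br (\sum_(i <- r) f i) z = \sum_(i <- r) br (f i) z.
Proof.
by elim: r => [|i r IHr]; rewrite ?big_nil ?br0l // !big_cons brDl IHr.
Qed.

Fixpoint tree_val (e : nat -> V) t :=
  match t with
  | Leaf i => e i
  | Node l r => br (tree_val e l) (tree_val e r)
  end.

Definition word_val (e : nat -> V) (w : lie_word) :=
  foldl br (e w.1) [seq e i | i <- w.2].

Lemma br_levall (T : Type) (g : T -> V) s x :
  br (leval g s) x = leval (fun k => br (g k) x) s.
Proof. by rewrite /leval br_suml; apply: eq_bigr => p _; rewrite brZl. Qed.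

(** By the Jacobi identity, right bracketing with [[l, r]] is a commutator of the right bracketings
    with [l] and [r], as in the recursion of [bracket_word]. *)
Lemma leval_bracket_word e w t :
  leval (word_val e) (bracket_word w t) = br (word_val e w) (tree_val e t).
Proof.
elim: t w => [i|l IHl r IHr] w /=.
  by rewrite /leval big_seq1 scale1r /word_val map_rcons foldl_rcons.
rewrite leval_cat leval_scale scaleN1r !leval_subst br_jacobi.
rewrite (eq_leval _ (fun v => IHr v)) -br_levall IHl.
by rewrite (eq_leval _ (fun v => IHl v)) -br_levall IHr.
Qed.

Lemma leval_normal_form e m t :
  leval (word_val e) (normal_form m t) = tree_val e t.
Proof.
elim: t => [i|l IHl r IHr] /=; first by rewrite /leval big_seq1 scale1r.
case: ifP => _; rewrite ?leval_scale leval_subst.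
  by rewrite (eq_leval _ (fun v => leval_bracket_word e v r)) -br_levall IHl.
rewrite (eq_leval _ (fun v => leval_bracket_word e v l)) -br_levall IHr.
by rewrite scaleN1r -brC.
Qed.

Lemma lie_identity e s : lie_vanishes s -> leval (tree_val e) s = 0.
Proof.
move/(leval_vanishes (word_val e)); rewrite leval_subst => <-.
by apply: eq_leval => t; rewrite leval_normal_form.
Qed.

Lemma tree_val_foldl e y ts :
  tree_val e (foldl Node y ts) = foldl br (tree_val e y) [seq tree_val e t | t <- ts].
Proof. by elim: ts y => //= t ts IHts y; rewrite IHts. Qed.

Lemma enum_ord4 : enum 'I_4 = [seq inord i | i <- iota 0 4].
Proof. by apply: (inj_map val_inj); rewrite val_enum_ord /= !inordK. Qed.

Lemma leval_std_tree e y xs :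
  leval (tree_val e) (std_tree y xs) =
  \sum_(s : 'S_4) ((-1) ^+ odd_perm s : K) *:
    foldl br (tree_val e y)
      [seq tree_val e (nth y xs (s (inord i))) | i <- iota 0 4].
Proof.
pose G (b : bool) t := ((-1) ^+ b : K) *:
  foldl br (tree_val e y) [seq tree_val e (nth y xs i) | i <- t].
rewrite /leval big_map [LHS](eq_bigr (fun p => G p.1 p.2)); last first.
  move=> p _; rewrite /G /= tree_val_foldl -map_comp rmorphXn /=.
  by rewrite rmorphN1.
rewrite -sum_signed_perms; apply: eq_bigr => s _.
by rewrite /G /perm_vals enum_ord4 -!map_comp.
Qed.

(** Passes to the form in which identities are checked by computation; a list [xs] that is too short
    is padded with [y]. *)
Lemma standard5P :
  standard5 br <-> forall e y xs, leval (tree_val e) (std_tree y xs) = 0.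
Proof.
split=> [std e y xs|std x y].
  rewrite leval_std_tree.
  exact: (std (fun i => tree_val e (nth y xs i)) (tree_val e y)).
pose e i := if i == 4%N then y else x (inord i).
have := std e (Leaf 4) [seq Leaf i | i <- iota 0 4].
rewrite leval_std_tree => std0; rewrite -[RHS]std0.
apply: eq_bigr => s _; congr (_ *: _).
have eE (i : 'I_4) : x i = tree_val e (nth (Leaf 4) [seq Leaf j | j <- iota 0 4] i).
  rewrite (nth_map 0%N) ?size_iota ?nth_iota ?ltn_ord //= /e ltn_eqF ?ltn_ord //.
  by rewrite add0n inord_val.
by rewrite !eE.
Qed.

(** * The ideal spanned by the values of the standard polynomial *)

Inductive std_span : V -> Prop :=
  | std_span0 : std_span 0
  | std_spanD a e y xs v :
      std_span v -> std_span (a *: leval (tree_val e) (std_tree y xs) + v).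

Lemma std_span_lin a u v : std_span u -> std_span v -> std_span (a *: u + v).
Proof.
move=> su sv; elim: su => [|b e y xs w _ IHw]; first by rewrite scaler0 add0r.
by rewrite scalerDr scalerA -addrA; apply: std_spanD.
Qed.

Lemma std_span_std e y xs : std_span (leval (tree_val e) (std_tree y xs)).
Proof.
by rewrite -[leval _ _]scale1r -[_ *: _]addr0; apply/std_spanD/std_span0.
Qed.

(** Bracketing with [u] is a derivation, so it acts on a value by bracketing each argument in turn.
    The list [xs 4] leaves all four letters unchanged, 4 being out of range. *)
Definition std_derivation : seq (int * lie_tree) :=
  let y := Leaf 4 in let u := Leaf 5 in
  let xs i := [seq if j == i then Node (Leaf j) u else Leaf j | j <- iota 0 4] in
  [seq (p.1, Node p.2 u) | p <- std_tree y (xs 4%N)]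
  ++ scale_terms (-1) (std_tree (Node y u) (xs 4%N)
       ++ flatten [seq std_tree y (xs i) | i <- iota 0 4]).

Lemma std_derivation_vanishes : lie_vanishes std_derivation.
Proof. by vm_compute. Qed.

Lemma eq_std_tree e e' y y' xs xs' :
    tree_val e y = tree_val e' y' ->
    (forall i : 'I_4, tree_val e (nth y xs i) = tree_val e' (nth y' xs' i)) ->
  leval (tree_val e) (std_tree y xs) = leval (tree_val e') (std_tree y' xs').
Proof.
move=> eq_y eq_xs; rewrite !leval_std_tree; apply: eq_bigr => s _ /=.
by rewrite eq_y !eq_xs.
Qed.

Lemma std_span_add u v : std_span u -> std_span v -> std_span (u + v).
Proof. by move=> su sv; rewrite -[u]scale1r; apply: std_span_lin. Qed.

Lemma std_span_br u v : std_span v -> std_span (br v u).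
Proof.
elim=> [|a e y xs w _ IHw]; first by rewrite br0l; apply: std_span0.
rewrite brDl brZl; apply: std_span_lin => //.
pose e' i := if (i < 4)%N then tree_val e (nth y xs i)
             else if i == 4%N then tree_val e y else u.
rewrite (@eq_std_tree e e' y (Leaf 4) xs [seq Leaf j | j <- iota 0 4]) //; last first.
  move=> i; rewrite (nth_map 0%N) ?size_iota ?nth_iota ?ltn_ord //= /e'.
  by rewrite ltn_ord.
have := lie_identity e' std_derivation_vanishes.
rewrite /std_derivation leval_cat leval_scale scaleN1r => /eqP.
rewrite subr_eq0 /leval big_map -!/(leval _ _) => /eqP eq_der.
rewrite br_levall [leval _ _]eq_der leval_cat; apply: std_span_add.
  exact: std_span_std.
rewrite /leval big_flatten big_map; apply: big_ind => [||i _].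
- exact: std_span0.
- exact: std_span_add.
- exact: std_span_std.
Qed.

Lemma std_span_ideal : lie_ideal br std_span.
Proof.
split; [exact: std_span0|exact: std_span_lin|move=> x y sy].
rewrite brC -scaleN1r -[_ *: _]addr0.
by apply: std_span_lin; [apply: std_span_br|apply: std_span0].
Qed.

(** * Cocycles vanish on the standard polynomial *)

Section Cocycle.
Variable phi : V -> V -> K.
Hypothesis phi_cocycle : comm_cocycle br phi.

Lemma phiC x y : phi x y = phi y x.
Proof. by case: phi_cocycle. Qed.

Lemma phi0l z : phi 0 z = 0.
Proof.
case: phi_cocycle => phil _ _ _; have := phil 1 0 0 z.
by rewrite scale1r addr0 mul1r => /eqP; rewrite -subr_eq subrr eq_sym => /eqP.
Qed.

Lemma phi_levall (T : Type) (g : T -> V) s x :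
  phi (leval g s) x = leval (fun k => phi (g k) x : K^o) s.
Proof.
case: phi_cocycle => phil _ _ _.
elim: s => [|p s IHs]; first by rewrite /leval !big_nil phi0l.
by rewrite !leval_cons phil IHs.
Qed.

Definition pair_val e (p : lie_tree * lie_tree) : K^o :=
  phi (tree_val e p.1) (tree_val e p.2).

Lemma pair_identity e s : pair_vanishes s -> leval (pair_val e) s = 0.
Proof.
pose g (w : lie_word * lie_word) : K^o := phi (word_val e w.1) (word_val e w.2).
move/(leval_vanishes g); rewrite leval_subst => <-; apply: eq_leval => -[t u].
rewrite /pair_val /pair_normal_form leval_subst -(leval_normal_form e (min_leaf t)).
rewrite phi_levall; apply: eq_leval => v /=.
rewrite -(leval_normal_form e (min_leaf u)) phiC phi_levall /leval big_map.
apply: eq_bigr => p _ /=; congr (_ *: _); rewrite /g /sort_pair.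
by case: ifP => _ //=; rewrite phiC.
Qed.

Lemma cocycle_terms_val e u v w : leval (pair_val e) (cocycle_terms u v w) = 0.
Proof.
case: phi_cocycle => _ _ _ cyc; rewrite /leval !big_cons big_nil /= !scale1r addr0.
by rewrite addrA; apply: cyc.
Qed.

Lemma phi_std e y xs z : (2%:R : K) != 0 -> (3%:R : K) != 0 ->
  phi (leval (tree_val e) (std_tree y xs)) z = 0.
Proof.
move=> two three.
pose e' i := if (i < 4)%N then tree_val e (nth y xs i)
             else if i == 4%N then tree_val e y else z.
rewrite (@eq_std_tree e e' y (Leaf 4) xs [seq Leaf j | j <- iota 0 4]) //; last first.
  move=> i; rewrite (nth_map 0%N) ?size_iota ?nth_iota ?ltn_ord //= /e'.
  by rewrite ltn_ord.
have := pair_identity e' std_certificate_vanishes.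
rewrite leval_cat !leval_scale leval_subst.
rewrite [X in _ + _ *: X](_ : _ = 0) ?scaler0 ?addr0; last first.
  rewrite /leval big1 // => p _; rewrite -/(leval _ _) leval_subst.
  rewrite [leval _ _](_ : _ = 0) ?scaler0 //.
  by rewrite /leval big1 // => q _; rewrite -/(leval _ _) cocycle_terms_val scaler0.
(* What remains is 12 times the value, and 12 = (2 * 2) * 3 is invertible. *)
move/eqP; rewrite scaler_eq0 rmorph_nat (natrM _ 4 3) (natrM _ 2 2) !mulf_eq0.
rewrite (negPf two) (negPf three) !orFb => /eqP std0.
by rewrite phi_levall -[RHS]std0 [in RHS]/leval big_map.
Qed.

Lemma cocycle_standard5 : simple_lie br -> (2%:R : K) != 0 -> (3%:R : K) != 0 ->
  (exists x y, phi x y != 0) -> standard5 br.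
Proof.
move=> [_ simple] two three [x [y phi_xy]]; apply/standard5P => e z xs.
case: (simple _ std_span_ideal) => [std0|all_std].
  by apply: std0; apply: std_span_std.
suff phi0 v : std_span v -> phi v y = 0 by rewrite phi0 ?eqxx in phi_xy.
case: phi_cocycle => phil _ _ _.
elim=> [|a f t ts w _ IHw]; first exact: phi0l.
by rewrite phil IHw phi_std // mulr0 addr0.
Qed.

End Cocycle.

(** * Simple algebras and the identity (ad a)^3 = 0 *)

Lemma simple_center0 x : simple_lie br -> (forall y, br x y = 0) -> x = 0.
Proof.
move=> [[u [v uv]] simple] xC.
have idealC : lie_ideal br (fun x => forall y, br x y = 0).
  split=> [y|a v1 v2 h1 h2 y|w z zC y]; first exact: br0l.
    by rewrite brDl brZl h1 h2 scaler0 addr0.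
  by rewrite (brC w z) zC oppr0 br0l.
case: (simple _ idealC) => [C0|center]; first exact: C0.
by rewrite center eqxx in uv.
Qed.

Lemma foldl_br_lin a x y us :
  foldl br (a *: x + y) us = a *: foldl br x us + foldl br y us.
Proof. by elim: us x y => //= u us IHus x y; rewrite brDl brZl IHus. Qed.

Lemma foldl_br0 us : foldl br 0 us = 0.
Proof. by elim: us => //= u us IHus; rewrite br0l. Qed.

Lemma foldl_brD x y us : foldl br (x + y) us = foldl br x us + foldl br y us.
Proof. by rewrite -[x in LHS]scale1r foldl_br_lin scale1r. Qed.

Lemma foldl_brN x us : foldl br (- x) us = - foldl br x us.
Proof.
by rewrite -scaleN1r -[_ *: x]addr0 foldl_br_lin foldl_br0 addr0 scaleN1r.
Qed.

Section Engel.
Hypothesis two : (2%:R : K) != 0.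
Hypothesis three : (3%:R : K) != 0.
Hypothesis simple : simple_lie br.
Hypothesis engel3 : forall x a, br (br (br x a) a) a = 0.

Lemma mulrn2_eq0 (v : V) : v + v = 0 -> v = 0.
Proof.
by rewrite -mulr2n -scaler_nat => /eqP; rewrite scaler_eq0 (negPf two) => /eqP.
Qed.

(** This is the part of degree 2 in [a] and 1 in [b] of the cubic identity at [a + b]. Replacing [b]
    by [- b] changes its sign but not that of the other mixed part, so it vanishes as 2 is
    invertible. *)
Lemma engel3_polar x a b :
  br (br (br x a) a) b + br (br (br x a) b) a + br (br (br x b) a) a = 0.
Proof.
pose S u v := br (br (br x u) u) v + br (br (br x u) v) u + br (br (br x v) u) u.
have SD u v : S u v + S v u = 0.
  have := engel3 x (u + v); rewrite !(brDl, brDr) !engel3 add0r addr0 => <-.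
  by rewrite /S !addrA [RHS](ACl (4*2*1*3*5*6)).
have SN u v : S u (- v) = - S u v by rewrite /S !(brNr, brNl) !opprD.
have SNl u v : S (- u) v = S u v by rewrite /S !(brNr, brNl) !opprK.
apply: mulrn2_eq0; rewrite -/(S a b).
have := SD a (- b); rewrite SN SNl => /eqP; rewrite addrC subr_eq0 => /eqP eqS.
by rewrite -{2}eqS SD.
Qed.

(** Full linearisation: the part of [engel3_polar] at [a + b] and [d] that is linear in each of the
    three. *)
Lemma engel3_polar3 x a b d :
  br (br (br x a) b) d + br (br (br x b) a) d + br (br (br x a) d) b
  + br (br (br x b) d) a + br (br (br x d) a) b + br (br (br x d) b) a = 0.
Proof.
have := engel3_polar x (a + b) d; rewrite !(brDl, brDr).
rewrite !addrA (ACl ((1*5*9)*(4*8*12)*(3*2*7*6*11*10))) /=.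
by rewrite !engel3_polar !add0r.
Qed.

Lemma sandwich_word c us :
  (forall x, br (br x c) c = 0) -> br (foldl br c us) c = 0.
Proof.
(* Interchanging two adjacent letters changes [c us] by a shorter word, so the
   value is symmetric in the first three letters, and [engel3_polar3] kills six
   times it. *)
move=> cc.
have cuc u : br (br c u) c = 0 by rewrite (brC c) brNl cc oppr0.
have [n] := ubnP (size us); elim: n us => // n IHn us.
have swap p y z vs : (size p + size vs < n.-1)%N ->
    br (foldl br (br (br (foldl br c p) y) z) vs) c
      = br (foldl br (br (br (foldl br c p) z) y) vs) c.
  move=> small; apply/eqP; rewrite -subr_eq0; apply/eqP.
  rewrite -brNl -brDl -foldl_brN -foldl_brD -br_jacobi.
  have := IHn (p ++ br y z :: vs); rewrite foldl_cat; apply.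
  by rewrite size_cat /= addnS -ltn_predRL.
case: us => [|y [|z [|t vs]]] /= lt_us; first exact: brxx.
- exact: cuc.
- apply: mulrn2_eq0; have := engel3_polar3 c y z c.
  rewrite brxx !cuc !br0l !addr0 => polar.
  rewrite -[RHS]polar; congr (_ + _).
  by apply: (swap [::] y z [::]); rewrite ltn_predRL.
have small (p ws : seq V) :
    (size p + size ws)%N = (size vs).+1 -> (size p + size ws < n.-1)%N.
  by move=> ->; rewrite ltn_predRL.
have s12 u v w := swap [::] u v (w :: vs) (small [::] (w :: vs) erefl).
have s23 u v w := swap [:: u] v w vs (small [:: u] vs erefl).
rewrite /= in s12 s23.
have := congr1 (fun v => br (foldl br v vs) c) (engel3_polar3 c y z t).
rewrite !foldl_brD foldl_br0 br0l !brDl.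
rewrite (s23 t z y) (s12 t y z) -(s23 y z t) (s23 z t y) (s12 z y t).
set w := br _ c => w6; have /eqP : w *+ 6 = 0 by rewrite !mulrSr mulr0n add0r.
rewrite -scaler_nat scaler_eq0 (natrM _ 2 3) mulf_eq0 (negPf two) (negPf three).
by move/eqP.
Qed.

(** The elements [v] such that every left-normed word starting with [v] commutes with [c] form an
    ideal, containing [c] by [sandwich_word]. By simplicity it is zero, or it is everything and [c]
    is central. *)
Lemma sandwich_eq0 c : (forall x, br (br x c) c = 0) -> c = 0.
Proof.
move=> cc.
have idealJ : lie_ideal br (fun v => forall us, br (foldl br v us) c = 0).
  split=> [us|a u v hu hv us|x v hv us].
  - by rewrite foldl_br0 br0l.
  - by rewrite foldl_br_lin brDl brZl hu hv scaler0 addr0.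
  - by rewrite (brC x) foldl_brN brNl (hv (x :: us)) oppr0.
case: simple => _ /(_ _ idealJ)[J0|Jall].
  by apply: J0 => us; apply: sandwich_word.
by apply: simple_center0 => // y; rewrite brC (Jall y [::]) oppr0.
Qed.

Lemma engel3_sandwich x a b :
  br (br x (br (br b a) a)) (br (br b a) a) = 0.
Proof.
(* Writing [A] and [B] for the right multiplications by [a] and [b], and letting
   operators act on the right: [ad [[b,a],a] = -3 ABA], and
   [(ABA)(ABA) = AB(AABA) = -(ABAB)AA = -(BABA)AA = -BAB(AAA) = 0]. *)
have adc y : br y (br (br b a) a) = - 3%:R *: br (br (br y a) b) a.
  have := engel3_polar y a b; rewrite !br_jacobi brDl brNl scaleNr scaler_nat.
  set P := br _ b; set Q := br (br (br y a) b) a; set R := br (br (br y b) a) a.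
  move=> PQR; rewrite -[RHS]add0r -PQR opprB mulrS mulr2n !opprD !addrA.
  by rewrite [RHS](ACl (3*5*1*6*(2*4))) /= subrr addr0.
have bc : br (br (br b a) a) b = 0.
  apply: mulrn2_eq0; have := engel3_polar b a b.
  rewrite brxx !br0l addr0 => polar; rewrite -[RHS]polar; congr (_ + _).
  by have := brxx (br b a); rewrite br_jacobi => /eqP; rewrite subr_eq0 => /eqP.
(* As [[[b,a],a]] commutes with [b], so do their right bracketings; cancelling -3 leaves ABAB =
   BABA. *)
have comm y : br (br (br (br y a) b) a) b = br (br (br (br y b) a) b) a.
  have /eqP : br y (br (br (br b a) a) b) = 0 by rewrite bc br0r.
  rewrite br_jacobi !adc brZl subr_eq0 => /eqP; apply: scalerI.
  by rewrite oppr_eq0.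
have slide y : br (br (br (br y a) a) b) a = - br (br (br (br y a) b) a) a.
  have := engel3_polar (br y a) a b.
  by rewrite engel3 br0l add0r => /eqP; rewrite addr_eq0 => /eqP.
by rewrite !adc !brZl slide comm engel3 oppr0 !scaler0.
Qed.

Lemma engel3_not_simple : False.
Proof.
case: simple => -[x [y xy]] _.
have engel2 a u : br (br u a) a = 0.
  by apply: sandwich_eq0 => v; apply: engel3_sandwich.
suff x0 : x = 0 by rewrite x0 br0l eqxx in xy.
by apply: sandwich_eq0 => v; apply: engel2.
Qed.

End Engel.

(** * The cocycle polynomial and the converse *)

(** This is [F(a,b;c,d)], with the parameters [c] and [d] first so that it becomes a map of [a] and
    [b]. *)
Definition cocycle_poly (c d a b : V) : V :=
  br (br (br c d) a) b + br (br (br c d) b) a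
  + 2%:R *: (br (br a c) (br b d) + br (br b c) (br a d)).

Lemma cocycle_polyC c d a b : cocycle_poly c d a b = cocycle_poly c d b a.
Proof. by congr (_ + _ *: _); rewrite addrC. Qed.

Lemma cocycle_poly_lin c d k x y b :
  cocycle_poly c d (k *: x + y) b = k *: cocycle_poly c d x b + cocycle_poly c d y b.
Proof.
rewrite /cocycle_poly !(brDl, brDr, brZl, brZr) !scalerDr !scalerA.
by rewrite ![_ * k]mulrC !addrA [LHS](ACl (1*3*5*7*2*4*6*8)).
Qed.

Lemma cocycle_poly_cyclic c d x y z : standard5 br ->
  cocycle_poly c d (br x y) z + cocycle_poly c d (br z x) y
  + cocycle_poly c d (br y z) x = 0.
Proof.
move=> /standard5P std; pose e := nth 0 [:: c; d; x; y; z].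
have := lie_identity e cocycle_poly_certificate_vanishes.
rewrite !leval_cat !leval_scale !std !scaler0 !addr0 addrA => cyc.
rewrite -[RHS]cyc /leval !big_cons !big_nil /= !scale1r !addr0.
by rewrite /cocycle_poly !scalerDr !addrA.
Qed.

Lemma cocycle_poly_engel : (2%:R : K) != 0 ->
    (forall c d a b, cocycle_poly c d a b = 0) ->
  forall x a, br (br (br x a) a) a = 0.
Proof.
move=> two poly0 x a; apply: (mulrn2_eq0 two).
by have := poly0 x a a a; rewrite /cocycle_poly brxx !br0r addr0 scaler0 addr0.
Qed.

Lemma standard5_cocycle : simple_lie br -> (2%:R : K) != 0 -> (3%:R : K) != 0 ->
  standard5 br ->
  exists phi : V -> V -> K, comm_cocycle br phi /\ exists x y, phi x y != 0.
Proof.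
move=> simple two three std.
have [c [d [a [b nz]]]] : exists c d a b, cocycle_poly c d a b != 0.
  apply: contrapT => none; apply: (engel3_not_simple two three simple).
  apply: cocycle_poly_engel => // c d a b.
  by apply: contrapT => /eqP nz; apply: none; exists c, d, a, b.
have [f [flin fnz]] := linear_form_neq0 nz.
exists (fun x y => f (cocycle_poly c d x y)); split; last by exists a, b.
split=> [k x y z|k x y z|x y|x y z].
- by rewrite cocycle_poly_lin flin.
- by rewrite !(cocycle_polyC c d z) cocycle_poly_lin flin.
- by rewrite cocycle_polyC.
have fD u v : f (u + v) = f u + f v by rewrite -[u in LHS]scale1r flin mul1r.
have f0 : f 0 = 0 by apply: (addrI (f 0)); rewrite -fD !addr0.
by rewrite -!fD cocycle_poly_cyclic.
Qed.

End LieAlgebra.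

Theorem theorem2p3 (K : fieldType) (V : lmodType K) (br : V -> V -> V) :
  is_lie br -> simple_lie br ->
  (2%:R : K) != 0 -> (3%:R : K) != 0 ->
  ((exists phi : V -> V -> K, comm_cocycle br phi /\ exists x y, phi x y != 0)
   <-> standard5 br).
Proof.
move=> lie simple two three; split=> [[phi [cocycle nz]]|].
  exact: (cocycle_standard5 lie cocycle).
exact: standard5_cocycle.
Qed.
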